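(* Let $n\ge0$ be an integer and let $|z|<1$. Then the following closed forms hold: $${}_2F_1\bigl(\tfrac12+n,1+n;\tfrac32+n;z\bigr)=\frac{1+2n}{4^{n}z^{n+1/2}}\Biggl[\binom{2n}{n}\arcsin\sqrt{\tfrac{z}{z-1}}+(-1)^n\Biggl(\sum_{k=0}^{n-1}+\sum_{k=1+n}^{2n}\Biggr)(-1)^k\binom{2n}{k}\frac{\sin\bigl[2(n-k)\arcsin\sqrt{\tfrac{z}{z-1}}\,\bigr]}{2(n-k)}\Biggr]$$ and $${}_2F_1\bigl(1+n,\tfrac32+n;2+n;z\bigr)=\frac{1+n}{4^{n}z^{1+n}}\sum_{k=0}^{1+2n}(-1)^k\binom{1+2n}{k}\frac{\cos\bigl[(2n-2k+1)\arcsin\sqrt{\tfrac{z}{z-1}}\,\bigr]-1}{2n-2k+1}.$$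
   Context: The Gauss hypergeometric function is ${}_2F_1(a,b;c;z)=\sum_{m=0}^{\infty}\frac{(a)_m(b)_m}{(c)_m}\frac{z^m}{m!}$ for $|z|<1$, where $(a)_0=1$ and $(a)_m=a(a+1)\dotsm(a+m-1)$ for $m\ge1$. The notation $\bigl(\sum_{k=0}^{n-1}+\sum_{k=1+n}^{2n}\bigr)a_k$ means $\sum_{k=0}^{n-1}a_k+\sum_{k=1+n}^{2n}a_k$, with empty sums equal to $0$.
   Formalization: In the first closed form the denominator z^{n+1/2} is replaced by (-z)^{n+1/2} (as printed it is off by a factor ±i, e.g. n=0, z=-1/3), z=0 is excluded since z stands in the denominators, and roots, arcsin and powers are principal branches. *)

(* Defs.v *)
From Stdlib Require Import Reals Factorial List.
From Coquelicot Require Export Coquelicot.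

Open Scope C_scope.

Definition Cexp (z : C) : C :=
  (exp (Re z) * cos (Im z), exp (Re z) * sin (Im z))%R.

(* Principal argument, with values in (-PI, PI]; in particular it equals PI on
   the negative real axis. The value at 0 carries no meaning. *)
Definition Carg (z : C) : R :=
  if Rle_dec 0 (Im z) then acos (Re z / Cmod z) else (- acos (Re z / Cmod z))%R.

Definition Clog (z : C) : C := (ln (Cmod z), Carg z).

(* Principal power z^a, meant for z <> 0. The first closed form is stated with
   (-z)^(n+1/2): for -1 < z < 0 the series and the arcsine terms are real while
   z^(n+1/2) is not, so it cannot hold with z^(n+1/2) on any branch. *)
Definition Cpower (z a : C) : C := Cexp (a * Clog z).

(* Principal square root, with Csqrt 0 = 0. *)
Definition Csqrt (z : C) : C := sqrt (Cmod z) * Cexp (Ci * (Carg z / 2)%R).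

Definition Csin (z : C) : C := (Cexp (Ci * z) - Cexp (- (Ci * z))) / (2 * Ci).
Definition Ccos (z : C) : C := (Cexp (Ci * z) + Cexp (- (Ci * z))) / 2.

(* Principal branch, with cuts ]-oo, -1[ and ]1, +oo[ on the real axis. *)
Definition Carcsin (w : C) : C := - Ci * Clog (Ci * w + Csqrt (1 - w * w)).

Fixpoint pochhammer (a : C) (m : nat) : C :=
  match m with
  | O => 1
  | S m' => pochhammer a m' * (a + INR m')
  end.

Definition hyp2F1_coeff (a b c : C) (m : nat) : C :=
  pochhammer a m * pochhammer b m / pochhammer c m / INR (fact m).

(* The Gauss series of parameters a, b, c converges at z, with sum l. *)
Definition is_hyp2F1 (a b c z l : C) : Prop :=
  @is_pseries C_AbsRing C_NormedModule (hyp2F1_coeff a b c) z l.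

(* Sum of f k over p <= k < q; it is 0 when q <= p. *)
Definition Csum (f : nat -> C) (p q : nat) : C :=
  fold_right Cplus 0 (map f (seq p (q - p))).

(* The library name C for this coefficient clashes with the complex numbers. *)
Definition binom (n k : nat) : C := Binomial.C n k.

(* Main.v *)
(* Put b = (N+1)/2 and a = (N+2)/2 with N = 2n for the first form and N = 2n+1
   for the second; both series are then 2F1(b, a; b+1; z). Let t be the principal
   square root of -z, and theta_u = arctan (u t) for u in [0, 1]. On the ray
   u |-> u^2 z the binomial series sum (a)_m / m! (u^2 z)^m equals cos(theta_u)^(N+2),
   because both satisfy the same linear differential equation of order one. Hence
   u^(N+1) 2F1(b, a; b+1; u^2 z) has derivative (N+1) u^N cos(theta_u)^(N+2), which is
   (N+1) / t^(N+1) times the derivative of S(theta_u), with S the primitive of sin^N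
   that vanishes at 0; the sums in the closed forms are S, by expanding sin^N with the
   binomial theorem. At u = 1 the choice of t gives
   sin(theta_1) = sqrt(z/(z-1)) for the principal root, and theta_1 is its principal arcsine. *)
Require Import Defs.
From Stdlib Require Import Reals Factorial Lra Lia List.
From Coquelicot Require Import Coquelicot.
Open Scope C_scope.

(** * Exponential, and derivatives of complex functions of a real variable *)

Lemma C_eq (x y : C) : Re x = Re y -> Im x = Im y -> x = y.
Proof. destruct x, y; simpl; intros; subst; reflexivity. Qed.

Lemma RtoC_neq0 (x : R) : x <> 0%R -> RtoC x <> 0.
Proof. intros H E. apply H. now apply RtoC_inj. Qed.

Lemma Ci_sqr : Ci * Ci = -1.
Proof. apply C_eq; simpl; ring. Qed.

Lemma Cexp_plus (x y : C) : Cexp (x + y) = Cexp x * Cexp y.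
Proof.
  destruct x, y; apply C_eq; unfold Cexp; simpl; rewrite exp_plus, ?cos_plus, ?sin_plus; ring.
Qed.

Lemma Cexp_0 : Cexp 0 = 1.
Proof. apply C_eq; unfold Cexp; simpl; rewrite exp_0, ?cos_0, ?sin_0; ring. Qed.

Lemma Cexp_opp_mult (x : C) : Cexp x * Cexp (- x) = 1.
Proof. rewrite <- Cexp_plus, <- Cexp_0. f_equal. ring. Qed.

Lemma Cexp_neq0 (x : C) : Cexp x <> 0.
Proof.
  intros H. apply C1_nz. rewrite <- (Cexp_opp_mult x), H. ring.
Qed.

Lemma Cexp_opp (x : C) : Cexp (- x) = / Cexp x.
Proof.
  rewrite <- (Cmult_1_l (/ _)), <- (Cexp_opp_mult x). field. apply Cexp_neq0.
Qed.

Lemma Cexp_INR (x : C) (n : nat) : Cexp (INR n * x) = Cexp x ^ n.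
Proof.
  induction n as [|n IH].
  - simpl. rewrite <- Cexp_0. f_equal. ring.
  - rewrite S_INR, RtoC_plus, Cpow_S, <- IH, <- Cexp_plus. f_equal. ring.
Qed.

(** The variable is real, so differentiability splits over the two components; [auto_derive] and the
    real criterion for a constant function then apply to each of them. *)
Definition is_Cderive (f : R -> C) (u : R) (l : C) : Prop :=
  is_derive (fun v => Re (f v)) u (Re l) /\ is_derive (fun v => Im (f v)) u (Im l).

Lemma is_Cderive_val (f : R -> C) u l l' :
  is_Cderive f u l -> l = l' -> is_Cderive f u l'.
Proof. now intros H <-. Qed.

Lemma is_Cderive_ext (f g : R -> C) u l :
  (forall v, f v = g v) -> is_Cderive f u l -> is_Cderive g u l.
Proof.
  intros H [H1 H2]; split; (eapply is_derive_ext; [|eassumption]); intros v; simpl; now rewrite H.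
Qed.

Lemma is_Cderive_const (c : C) u : is_Cderive (fun _ => c) u 0.
Proof. split; apply (is_derive_const (K := R_AbsRing) (V := R_NormedModule)). Qed.

Lemma is_Cderive_id u : is_Cderive (fun v => RtoC v) u 1.
Proof.
  split; simpl; [apply (is_derive_id (K := R_AbsRing))|].
  apply (is_derive_const (K := R_AbsRing) (V := R_NormedModule) 0%R).
Qed.

Lemma is_Cderive_plus f g u l m :
  is_Cderive f u l -> is_Cderive g u m -> is_Cderive (fun v => f v + g v) u (l + m).
Proof.
  intros [H1 H2] [H3 H4]; split; simpl;
  apply (is_derive_plus (K := R_AbsRing) (V := R_NormedModule)); assumption.
Qed.

Lemma is_Cderive_mult f g u l m :
  is_Cderive f u l -> is_Cderive g u m ->
  is_Cderive (fun v => f v * g v) u (l * g u + f u * m).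
Proof.
  intros [H1 H2] [H3 H4]; split; simpl.
  - evar_last. apply (is_derive_minus (K := R_AbsRing) (V := R_NormedModule));
    apply (is_derive_mult (K := R_AbsRing)); try eassumption; intros; apply Rmult_comm.
    unfold Re, Im; simpl. unfold minus, plus, mult, opp; simpl. ring.
  - evar_last. apply (is_derive_plus (K := R_AbsRing) (V := R_NormedModule));
    apply (is_derive_mult (K := R_AbsRing)); try eassumption; intros; apply Rmult_comm.
    unfold Re, Im; simpl. unfold minus, plus, mult, opp; simpl. ring.
Qed.

Lemma is_Cderive_scal (c : C) f u l :
  is_Cderive f u l -> is_Cderive (fun v => c * f v) u (c * l).
Proof.
  intros H. eapply is_Cderive_val.
  apply is_Cderive_mult; [apply is_Cderive_const|exact H]. cbv beta; ring.
Qed.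

Lemma is_Cderive_opp f u l :
  is_Cderive f u l -> is_Cderive (fun v => - f v) u (- l).
Proof.
  intros H. eapply is_Cderive_ext, is_Cderive_val;
  [|apply (is_Cderive_scal (-1)), H|]; intros; cbv beta; ring.
Qed.

Lemma is_Cderive_minus f g u l m :
  is_Cderive f u l -> is_Cderive g u m -> is_Cderive (fun v => f v - g v) u (l - m).
Proof. intros H H'. apply is_Cderive_plus, is_Cderive_opp; assumption. Qed.

Lemma is_Cderive_pow f u l n :
  is_Cderive f u l -> is_Cderive (fun v => f v ^ S n) u (INR (S n) * f u ^ n * l).
Proof.
  intros H. induction n as [|n IH].
  - eapply is_Cderive_ext, is_Cderive_val; [|exact H|]; intros; simpl; ring.
  - eapply is_Cderive_ext, is_Cderive_val;
      [|exact (is_Cderive_mult _ _ _ _ _ H IH)|]; intros.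
    + rewrite (Cpow_S _ (S n)). reflexivity.
    + rewrite (S_INR (S n)), RtoC_plus, !Cpow_S. ring.
Qed.

Lemma is_Cderive_exp f u l :
  is_Cderive f u l -> is_Cderive (fun v => Cexp (f v)) u (l * Cexp (f u)).
Proof.
  unfold is_Cderive; intros [H1 H2].
  (* With the components named, [auto_derive] treats them as opaque differentiable real
     functions. *)
  set (p := fun v => Re (f v)) in *; set (q := fun v => Im (f v)) in *.
  split;
  [change (is_derive (fun v => (exp (p v) * cos (q v))%R) u
             (Re l * (exp (p u) * cos (q u)) - Im l * (exp (p u) * sin (q u)))%R)
  |change (is_derive (fun v => (exp (p v) * sin (q v))%R) u
             (Re l * (exp (p u) * sin (q u)) + Im l * (exp (p u) * cos (q u)))%R)];
  (auto_derive; [repeat split; eexists; eassumption|]);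
  change (Derive (fun x => p x)) with (Derive p);
  change (Derive (fun x => q x)) with (Derive q);
  rewrite ?(is_derive_unique p _ _ H1), ?(is_derive_unique q _ _ H2); ring.
Qed.

Lemma is_Cderive_comp_real f (g : R -> R) u l d :
  is_Cderive f (g u) l -> is_derive g u d -> is_Cderive (fun v => f (g v)) u (d * l).
Proof.
  intros [H1 H2] H; split.
  - evar_last. apply (is_derive_comp (fun v => Re (f v)) g); eassumption.
    unfold scal, Re, Im; simpl; unfold mult; simpl. ring.
  - evar_last. apply (is_derive_comp (fun v => Im (f v)) g); eassumption.
    unfold scal, Re, Im; simpl; unfold mult; simpl. ring.
Qed.

Lemma is_Cderive_0_eq f (a b : R) :
  (a < b)%R -> (forall u, (a <= u <= b)%R -> is_Cderive f u 0) -> f a = f b.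
Proof.
  intros Hab H. apply C_eq.
  - apply (eq_is_derive (fun v => Re (f v)) a b); auto. intros t Ht; apply (H t Ht).
  - apply (eq_is_derive (fun v => Im (f v)) a b); auto. intros t Ht; apply (H t Ht).
Qed.

(* On the right half-plane the principal logarithm is given by the smooth formula with [atan]. *)
Definition Clog_rhp (w : C) : C := ((ln (Re w ^ 2 + Im w ^ 2) / 2)%R, atan (Im w / Re w)).

Lemma Cexp_Clog_rhp (w : C) : (0 < Re w)%R -> Cexp (Clog_rhp w) = w.
Proof.
  destruct w as [p q]; intros Hp; simpl in Hp.
  assert (H2 : (0 < p ^ 2 + q ^ 2)%R) by nra.
  (* The modulus is written so that its square root cancels the denominators of [cos_atan] and
     [sin_atan]; p > 0 allows p to be pulled out of the root. *)
  assert (E : exp (ln (p ^ 2 + q ^ 2) / 2) = (p * sqrt (1 + (q / p)²))%R).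
  { rewrite <- (sqrt_Rsqr p) at 2 by lra. rewrite <- sqrt_mult;
    [|apply Rle_0_sqr|pose proof (Rle_0_sqr (q / p)); lra].
    replace (p² * (1 + (q / p)²))%R with (p ^ 2 + q ^ 2)%R
      by (unfold Rsqr; field; lra).
    rewrite <- Rpower_sqrt by assumption. unfold Rpower. f_equal. lra. }
  assert (Hs : (0 < sqrt (1 + (q / p)²))%R).
  { apply sqrt_lt_R0. pose proof (Rle_0_sqr (q / p)); lra. }
  unfold Clog_rhp, Cexp; cbn [Re Im fst snd].
  rewrite E, cos_atan, sin_atan.
  apply C_eq; simpl; field; lra.
Qed.

Lemma is_Cderive_Clog_rhp f u l :
  is_Cderive f u l -> (0 < Re (f u))%R ->
  is_Cderive (fun v => Clog_rhp (f v)) u (l / f u).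
Proof.
  unfold is_Cderive; intros [H1 H2].
  pose (p := fun v => Re (f v)); pose (q := fun v => Im (f v)).
  change (is_derive p u (Re l)) in H1; change (is_derive q u (Im l)) in H2.
  change (0 < p u -> is_derive (fun v => (ln (p v ^ 2 + q v ^ 2) / 2)%R) u (Re (l / f u)) /\
    is_derive (fun v => (atan (q v / p v))%R) u (Im (l / f u)))%R.
  replace (f u) with (p u, q u) by (unfold p, q; now destruct (f u)).
  intros Hp.
  assert (H3 : (0 < p u ^ 2 + q u ^ 2)%R) by (assert (X := pow2_ge_0 (q u)); nra).
  split; (auto_derive; [repeat split; try (eexists; eassumption); simpl in *; lra|]);
    change (Derive (fun x => p x)) with (Derive p);
  change (Derive (fun x => q x)) with (Derive q);
  rewrite ?(is_derive_unique p _ _ H1), ?(is_derive_unique q _ _ H2);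
    destruct l; simpl in *; field; unfold Rsqr; simpl; repeat split; nra.
Qed.

Lemma is_Cderive_sin f u l :
  is_Cderive f u l -> is_Cderive (fun v => Csin (f v)) u (Ccos (f u) * l).
Proof.
  intros H. unfold Csin, Ccos.
  eapply is_Cderive_ext, is_Cderive_val; [|apply (is_Cderive_scal (/ (2 * Ci)));
    apply is_Cderive_minus; apply is_Cderive_exp;
    [|apply is_Cderive_opp]; apply (is_Cderive_scal Ci), H|].
  - intros v; cbv beta. unfold Cdiv. ring.
  - cbv beta. field. apply Ci_nz.
Qed.

Lemma Cdiv_2Ci (x : C) : x / (2 * Ci) = - (Ci * x) / 2.
Proof. unfold Cdiv. apply C_eq; simpl; field. Qed.

Lemma is_Cderive_cos f u l :
  is_Cderive f u l -> is_Cderive (fun v => Ccos (f v)) u (- Csin (f u) * l).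
Proof.
  intros H. unfold Csin, Ccos.
  eapply is_Cderive_ext, is_Cderive_val; [|apply (is_Cderive_scal (/ 2));
    apply is_Cderive_plus; apply is_Cderive_exp;
    [|apply is_Cderive_opp]; apply (is_Cderive_scal Ci), H|].
  - intros v; cbv beta. unfold Cdiv. ring.
  - rewrite Cdiv_2Ci. cbv beta. field.
Qed.

(** * Finite sums and primitives of powers of the sine *)

Lemma Csum_nil f p : Csum f p p = 0.
Proof. unfold Csum. now rewrite PeanoNat.Nat.sub_diag. Qed.

Lemma Csum_Sr f p q : (p <= q)%nat -> Csum f p (S q) = Csum f p q + f q.
Proof.
  intros H. unfold Csum. rewrite PeanoNat.Nat.sub_succ_l, seq_S, map_app by assumption.
  rewrite fold_right_app. replace (p + (q - p))%nat with q by lia. simpl.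
  induction (map f (seq p (q - p))) as [|a s IH]; simpl; [ring|].
  rewrite IH. ring.
Qed.

(** Induction on the upper bound of a sum with its lower bound p fixed; the base case is the empty
    sum. *)
Lemma Csum_ind (P : nat -> Prop) p q :
  (p <= q)%nat -> P p -> (forall r, (p <= r < q)%nat -> P r -> P (S r)) -> P q.
Proof.
  intros H P0 PS. induction H as [|q H IH]; auto.
  apply PS; auto. apply IH. intros; apply PS; auto; lia.
Qed.

Lemma Csum_cat f p q r : (p <= q <= r)%nat -> Csum f p q + Csum f q r = Csum f p r.
Proof.
  intros [H1 H2]. apply (Csum_ind (fun r => Csum f p q + Csum f q r = Csum f p r) q r); auto.
  - rewrite Csum_nil. ring.
  - intros s Hs E. rewrite !Csum_Sr, <- E by lia. ring.
Qed.

Lemma Csum_ext f g p q :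
  (p <= q)%nat -> (forall k, (p <= k < q)%nat -> f k = g k) -> Csum f p q = Csum g p q.
Proof.
  intros H. apply (Csum_ind (fun q => (forall k, (p <= k < q)%nat -> f k = g k) -> Csum f p q = Csum g p q) p q); auto.
  - intros _. now rewrite !Csum_nil.
  - intros r Hr IH E. rewrite !Csum_Sr, E, IH by (try lia; intros; apply E; lia). reflexivity.
Qed.

Lemma Csum_plus f g p q :
  (p <= q)%nat -> Csum f p q + Csum g p q = Csum (fun k => f k + g k) p q.
Proof.
  intros H. apply (Csum_ind (fun q => Csum f p q + Csum g p q = Csum (fun k => f k + g k) p q) p q); auto.
  - rewrite !Csum_nil. ring.
  - intros r Hr E. rewrite !Csum_Sr, <- E by lia. ring.
Qed.

Lemma Csum_scal c f p q :
  (p <= q)%nat -> c * Csum f p q = Csum (fun k => c * f k) p q.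
Proof.
  intros H. apply (Csum_ind (fun q => c * Csum f p q = Csum (fun k => c * f k) p q) p q); auto.
  - rewrite !Csum_nil. ring.
  - intros r Hr E. rewrite !Csum_Sr, <- E by lia. ring.
Qed.

Lemma Csum_Sl f n : Csum f 0 (S n) = f O + Csum (fun k => f (S k)) 0 n.
Proof.
  induction n as [|n IH].
  - rewrite Csum_Sr, !Csum_nil by lia. ring.
  - rewrite Csum_Sr, IH, Csum_Sr by lia. ring.
Qed.

Lemma Csum_0 (f : nat -> C) p q :
  (p <= q)%nat -> (forall k, (p <= k < q)%nat -> f k = 0) -> Csum f p q = 0.
Proof.
  intros H. apply (Csum_ind (fun q => (forall k, (p <= k < q)%nat -> f k = 0) -> Csum f p q = 0) p q); auto.
  - intros _. apply Csum_nil.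
  - intros r Hr IH E. rewrite Csum_Sr, E, IH by (try lia; intros; apply E; lia). ring.
Qed.

Lemma is_Cderive_Csum f l u p q :
  (p <= q)%nat -> (forall k, (p <= k < q)%nat -> is_Cderive (fun v => f v k) u (l k)) ->
  is_Cderive (fun v => Csum (f v) p q) u (Csum l p q).
Proof.
  intros H. apply (Csum_ind (fun q => (forall k, (p <= k < q)%nat -> is_Cderive (fun v => f v k) u (l k)) ->
  is_Cderive (fun v => Csum (f v) p q) u (Csum l p q)) p q); auto.
  - intros _. rewrite Csum_nil. eapply is_Cderive_ext, is_Cderive_const.
    intros v; now rewrite Csum_nil.
  - intros r Hr IH E. rewrite Csum_Sr by lia.
    eapply is_Cderive_ext; [intros v; symmetry; apply Csum_Sr; lia|].
    apply is_Cderive_plus; [apply IH; intros; apply E|apply E]; lia.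
Qed.

Lemma Cbinomial (x y : C) n :
  (x + y) ^ n = Csum (fun k => binom n k * (x ^ k * y ^ (n - k))) 0 (S n).
Proof.
  assert (B0 : forall m, binom m 0 = 1) by (intros m; unfold binom; now rewrite C_n_0).
  assert (Bn : forall m, binom m m = 1) by (intros m; unfold binom; now rewrite C_n_n).
  induction n as [|n IH].
  - rewrite Csum_Sr, Csum_nil, B0 by lia. simpl. ring.
  - transitivity (x * (x + y) ^ n + y * (x + y) ^ n); [rewrite Cpow_S; ring|].
    rewrite (Csum_Sr _ 0 (S n)), Csum_Sl, B0, Bn by lia.
    (* Both products are indexed by the power [x ^ S k], with the extreme terms [x ^ S n] and
       [y ^ S n] peeled off, because Pascal's rule concerns the interior coefficients only. *)
    assert (Ex : x * (x + y) ^ n =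
      Csum (fun k => binom n k * (x ^ S k * y ^ (n - k))) 0 n + x ^ S n).
    { rewrite IH, Csum_Sr, Bn, PeanoNat.Nat.sub_diag by lia.
      rewrite Cmult_plus_distr_l, Csum_scal by lia. f_equal.
      - apply Csum_ext; [lia|]. intros k Hk. rewrite Cpow_S. ring.
      - rewrite Cpow_S. simpl. ring. }
    assert (Ey : y * (x + y) ^ n =
      y ^ S n + Csum (fun k => binom n (S k) * (x ^ S k * y ^ (n - k))) 0 n).
    { rewrite IH, Csum_Sl, B0, PeanoNat.Nat.sub_0_r.
      rewrite Cmult_plus_distr_l, Csum_scal by lia. f_equal.
      - rewrite Cpow_S. simpl. ring.
      - apply Csum_ext; [lia|]. intros k Hk.
        replace (n - k)%nat with (S (n - S k)) by lia. rewrite (Cpow_S y). ring. }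
    rewrite Ex, Ey.
    transitivity (y ^ S n +
      (Csum (fun k => binom n k * (x ^ S k * y ^ (n - k))) 0 n +
       Csum (fun k => binom n (S k) * (x ^ S k * y ^ (n - k))) 0 n) + x ^ S n); [ring|].
    rewrite Csum_plus, PeanoNat.Nat.sub_diag by lia.
    replace (S n - 0)%nat with (S n) by lia.
    f_equal; [|simpl; ring]. f_equal; [simpl; ring|].
    apply Csum_ext; [lia|]. intros k Hk.
    unfold binom. rewrite <- pascal, RtoC_plus by lia. simpl Nat.sub. ring.
Qed.

Lemma Csin_opp x : Csin (- x) = - Csin x.
Proof.
  unfold Csin. replace (Ci * - x) with (- (Ci * x)) by ring.
  replace (- - (Ci * x)) with (Ci * x) by ring. field. apply Ci_nz.
Qed.

(** Binomial expansion of (exp(ix) - exp(-ix))^n, where k counts the factors -exp(-ix). *)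
Lemma Cpow_2Ci_Csin x n :
  (2 * Ci * Csin x) ^ n =
  Csum (fun k => (-1) ^ k * binom n k * Cexp (Ci * ((INR n - 2 * INR k) * x))) 0 (S n).
Proof.
  replace (2 * Ci * Csin x) with (-1 * Cexp (- (Ci * x)) + Cexp (Ci * x))
    by (unfold Csin; field; apply Ci_nz).
  rewrite Cbinomial. apply Csum_ext; [lia|]. intros k Hk.
  rewrite Cpow_mult_l, <- !Cexp_INR, minus_INR, RtoC_minus by lia.
  transitivity ((-1) ^ k * binom n k *
    (Cexp (INR k * - (Ci * x)) * Cexp ((INR n - INR k) * (Ci * x)))); [ring|].
  rewrite <- Cexp_plus. do 2 f_equal. ring.
Qed.

Lemma Cpow_opp_even x n : (- x) ^ (2 * n) = x ^ (2 * n).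
Proof. rewrite !Cpow_mult_r. f_equal. simpl. ring. Qed.

Lemma Cpow_2Ci_even x n : (2 * Ci * x) ^ (2 * n) = (-1) ^ n * 4 ^ n * x ^ (2 * n).
Proof.
  rewrite !Cpow_mult_r, <- !Cpow_mult_l. f_equal. simpl.
  transitivity (4 * (Ci * Ci) * (x * x)); [ring|]. rewrite Ci_sqr. ring.
Qed.

(** The mean of the exponential expansions at x and -x pairs the exponentials into cosines, and an
    even power of the sine takes the same value at both points. *)
Lemma Csum_Ccos x n :
  Csum (fun k => (-1) ^ k * binom (2 * n) k * Ccos (2 * (INR n - INR k) * x)) 0 (1 + 2 * n)
  = (-1) ^ n * 4 ^ n * Csin x ^ (2 * n).
Proof.
  transitivity (/ 2 * ((2 * Ci * Csin x) ^ (2 * n) + (2 * Ci * Csin (- x)) ^ (2 * n))).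
  - rewrite !Cpow_2Ci_Csin, Csum_plus, Csum_scal by lia.
    apply Csum_ext; [lia|]. intros k Hk.
    rewrite mult_INR, RtoC_mult. change (INR 2) with 2%R. unfold Ccos.
    replace (Ci * ((2 * INR n - 2 * INR k) * x)) with (Ci * (2 * (INR n - INR k) * x)) by ring.
    replace (Ci * ((2 * INR n - 2 * INR k) * - x)) with (- (Ci * (2 * (INR n - INR k) * x))) by ring.
    field.
  - rewrite Csin_opp, !Cpow_2Ci_even, Cpow_opp_even. field.
Qed.

(** Here half the difference of the expansions at x and -x is used: an odd power of the sine changes
    sign, so the two contributions add up. *)
Lemma Csum_Csin x n :
  Csum (fun k => (-1) ^ k * binom (1 + 2 * n) k * Csin ((2 * INR n - 2 * INR k + 1) * x)) 0 (2 + 2 * n)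
  = 2 * (-1) ^ n * 4 ^ n * Csin x ^ (1 + 2 * n).
Proof.
  transitivity (/ (2 * Ci) * ((2 * Ci * Csin x) ^ (1 + 2 * n) + -1 * (2 * Ci * Csin (- x)) ^ (1 + 2 * n))).
  - rewrite !Cpow_2Ci_Csin, (Csum_scal (-1)), Csum_plus, Csum_scal by lia.
    apply Csum_ext; [lia|]. intros k Hk.
    rewrite plus_INR, mult_INR, RtoC_plus, RtoC_mult.
    change (INR 2) with 2%R. change (INR 1) with 1%R. unfold Csin.
    replace (Ci * ((1 + 2 * INR n - 2 * INR k) * x)) with (Ci * ((2 * INR n - 2 * INR k + 1) * x)) by ring.
    replace (Ci * ((1 + 2 * INR n - 2 * INR k) * - x)) with (- (Ci * ((2 * INR n - 2 * INR k + 1) * x))) by ring.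
    field. apply Ci_nz.
  - rewrite Csin_opp. change (1 + 2 * n)%nat with (S (2 * n)). rewrite !Cpow_S, !Cpow_2Ci_even, Cpow_opp_even.
    field. apply Ci_nz.
Qed.

Lemma Csin_0 : Csin 0 = 0.
Proof.
  unfold Csin. replace (- (Ci * 0)) with (Ci * 0) by ring. field. apply Ci_nz.
Qed.

Lemma Ccos_0 : Ccos 0 = 1.
Proof.
  unfold Ccos. replace (- (Ci * 0)) with (Ci * 0) by ring.
  replace (Ci * 0) with (RtoC 0) by ring. rewrite Cexp_0. field.
Qed.

(** This is 4^n times the primitive of sin^(2n) that vanishes at 0. The index k = n has frequency
    zero and integrates to the linear term. *)
Definition int_sin_even (n : nat) (x : C) : C :=
  let term := fun k : nat =>
     (-1) ^ k * binom (2 * n) k *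
     (Csin (2 * (INR n - INR k) * x) / (2 * (INR n - INR k))) in
  binom (2 * n) n * x + (-1) ^ n * (Csum term 0 n + Csum term (1 + n) (1 + 2 * n)).

(** This is -2 (-1)^n 4^n times the primitive of sin^(2n+1) that vanishes at 0; subtracting 1 from
    each cosine makes every summand vanish there. *)
Definition int_sin_odd (n : nat) (x : C) : C :=
  Csum (fun k : nat =>
       (-1) ^ k * binom (1 + 2 * n) k *
       ((Ccos ((2 * INR n - 2 * INR k + 1) * x) - 1) /
        (2 * INR n - 2 * INR k + 1))) 0 (2 + 2 * n).

Lemma int_sin_even_0 n : int_sin_even n 0 = 0.
Proof.
  assert (T : forall k, (-1) ^ k * binom (2 * n) k *
     (Csin (2 * (INR n - INR k) * 0) / (2 * (INR n - INR k))) = 0)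
    by (intros k; rewrite Cmult_0_r, Csin_0; unfold Cdiv; ring).
  unfold int_sin_even. cbv zeta.
  rewrite (Csum_0 _ 0 n), (Csum_0 _ (1 + n)) by (try lia; intros; apply T). ring.
Qed.

Lemma int_sin_odd_0 n : int_sin_odd n 0 = 0.
Proof.
  unfold int_sin_odd. apply Csum_0; [lia|].
  intros k Hk; rewrite Cmult_0_r, Ccos_0; unfold Cdiv; ring.
Qed.

Lemma Cpow_m1_sqr n : (-1) ^ n * (-1) ^ n = 1.
Proof. rewrite <- Cpow_mult_l, <- (Cpow_1_l n). f_equal. ring. Qed.

Lemma is_Cderive_int_sin_even n f u l :
  is_Cderive f u l ->
  is_Cderive (fun v => int_sin_even n (f v)) u (4 ^ n * Csin (f u) ^ (2 * n) * l).
Proof.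
  intros H.
  set (dterm := fun k => (-1) ^ k * binom (2 * n) k * Ccos (2 * (INR n - INR k) * f u)).
  assert (D : forall k, k <> n -> is_Cderive (fun v => (-1) ^ k * binom (2 * n) k *
     (Csin (2 * (INR n - INR k) * f v) / (2 * (INR n - INR k)))) u (l * dterm k)).
  { intros k Hk.
    assert (Hk' : RtoC (INR n) - INR k <> 0).
    { rewrite <- RtoC_minus. apply RtoC_neq0. intros E. apply Hk, INR_eq; lra. }
    eapply is_Cderive_ext, is_Cderive_val;
      [|apply (is_Cderive_scal ((-1) ^ k * binom (2 * n) k / (2 * (INR n - INR k)))),
         is_Cderive_sin, (is_Cderive_scal (2 * (INR n - INR k))), H|];
      intros; cbv beta; unfold dterm; field; exact Hk'. }
  eapply is_Cderive_val.
  - apply is_Cderive_plus; [apply is_Cderive_scal, H|].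
    apply is_Cderive_scal, is_Cderive_plus; apply is_Cderive_Csum;
      try lia; intros k Hk; apply (D k); lia.
  - rewrite <- !Csum_scal by lia.
    (* The derivative of the linear term supplies the missing summand k = n, since cos 0 = 1 and
       (-1)^n squares to 1. The sum is then complete and [Csum_Ccos] evaluates it. *)
    transitivity (l * ((-1) ^ n * (Csum dterm 0 n + Csum dterm n (1 + n) + Csum dterm (1 + n) (1 + 2 * n)))).
    + replace (Csum dterm n (1 + n)) with (dterm n).
      * replace (dterm n) with ((-1) ^ n * binom (2 * n) n) by
          (unfold dterm; replace (2 * (INR n - INR n) * f u) with (RtoC 0) by ring;
           rewrite Ccos_0; ring).
        transitivity (((-1) ^ n * (-1) ^ n) * binom (2 * n) n * l +
          (-1) ^ n * (l * Csum dterm 0 n + l * Csum dterm (1 + n) (1 + 2 * n)));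
        [rewrite Cpow_m1_sqr|]; ring.
      * simpl. rewrite Csum_Sr, Csum_nil by lia. ring.
    + rewrite !Csum_cat by lia. unfold dterm. rewrite Csum_Ccos.
      transitivity ((-1) ^ n * (-1) ^ n * (4 ^ n * Csin (f u) ^ (2 * n) * l)); [ring|].
      rewrite Cpow_m1_sqr. ring.
Qed.

Lemma is_Cderive_int_sin_odd n f u l :
  is_Cderive f u l ->
  is_Cderive (fun v => int_sin_odd n (f v)) u
    (- 2 * (-1) ^ n * 4 ^ n * Csin (f u) ^ (1 + 2 * n) * l).
Proof.
  intros H.
  set (dterm := fun k => (-1) ^ k * binom (1 + 2 * n) k * Csin ((2 * INR n - 2 * INR k + 1) * f u)).
  eapply is_Cderive_val.
  - apply (is_Cderive_Csum _ (fun k => - l * dterm k)); [lia|]. intros k Hk.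
    (* The denominator is an odd integer, so no index has to be left out; [lia] sees this once the
       number is written as an [IZR]. *)
    assert (Hk' : 2 * INR n - 2 * INR k + 1 <> 0).
    { rewrite <- !RtoC_mult, <- RtoC_minus, <- RtoC_plus. apply RtoC_neq0.
      replace (2 * INR n - 2 * INR k + 1)%R with (IZR (2 * Z.of_nat n - 2 * Z.of_nat k + 1)).
      apply not_0_IZR; lia.
      rewrite plus_IZR, minus_IZR, !mult_IZR, <- !INR_IZR_INZ. reflexivity. }
    eapply is_Cderive_ext, is_Cderive_val;
      [|apply (is_Cderive_scal ((-1) ^ k * binom (1 + 2 * n) k / (2 * INR n - 2 * INR k + 1))),
         is_Cderive_minus; [apply is_Cderive_cos, (is_Cderive_scal (2 * INR n - 2 * INR k + 1)), H|
         apply (is_Cderive_const 1)]|];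
      intros; cbv beta; unfold dterm; field; exact Hk'.
  - rewrite <- Csum_scal by lia. unfold dterm. rewrite Csum_Csin. ring.
Qed.

(** * Complex power series on the real segment [0, 1] *)

(** A radius strictly above 1 puts the endpoint 1 inside the disc, so term by term differentiation
    is valid on the whole closed segment. *)
Definition CV_gt1 (a : nat -> C) : Prop :=
  Rbar_lt 1 (CV_radius (fun m => Re (a m))) /\ Rbar_lt 1 (CV_radius (fun m => Im (a m))).

Lemma CV_gt1_ratio (a : nat -> C) (l : R) :
  (forall m, a m <> 0) -> (0 < l < 1)%R ->
  is_lim_seq (fun m => Cmod (a (S m) / a m)) l -> CV_gt1 a.
Proof.
  intros Ha Hl Hlim.
  (* The midpoint r of 1 and 1/l is a radius above 1 at which d'Alembert's test still gives
     convergence for the moduli; both components are dominated by these. *)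
  assert (Hr : (1 < (1 + / l) / 2 < / l)%R).
  { assert (1 < / l)%R by (rewrite <- Rinv_1; apply Rinv_lt_contravar; lra). lra. }
  set (r := ((1 + / l) / 2)%R) in Hr.
  assert (D : CV_disk (fun m => Cmod (a m)) r).
  { apply (CV_disk_DAlembert _ _ l).
    - intros m H. apply (Ha m), Cmod_eq_0, H.
    - eapply is_lim_seq_ext; [|exact Hlim]. intros m. simpl.
      rewrite Cmod_div by auto. symmetry; apply Rabs_pos_eq.
      apply Rmult_le_pos; [apply Cmod_ge_0|].
      apply Rlt_le, Rinv_0_lt_compat, Cmod_gt_0, Ha.
    - right; split; [lra|]. rewrite Rabs_pos_eq; lra. }
  assert (K : forall b : nat -> R, (forall m, Rabs (b m) <= Cmod (a m))%R -> Rbar_lt 1 (CV_radius b)).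
  { intros b Hb. apply (Rbar_lt_le_trans _ r); [simpl; lra|].
    apply Lub_Rbar_correct. red in D |- *.
    apply (ex_series_le (K := R_AbsRing) (V := R_CompleteNormedModule)
      _ (fun n => Rabs (Cmod (a n) * r ^ n)%R)); [|exact D].
    intros n. unfold norm; simpl; unfold abs; simpl. rewrite Rabs_Rabsolu, !Rabs_mult.
    apply Rmult_le_compat_r; [apply Rabs_pos|].
    rewrite (Rabs_pos_eq (Cmod _)) by apply Cmod_ge_0. apply Hb. }
  split; apply K; intros m.
  - apply re_le_Cmod.
  - eapply Rle_trans; [apply Rmax_r|apply Rmax_Cmod].
Qed.

(** The variable is real: the powers of z are absorbed into the coefficients, so that v moves along
    the segment from 0 to z. *)
Definition CPS (a : nat -> C) (v : R) : C :=
  (PSeries (fun m => Re (a m)) v, PSeries (fun m => Im (a m)) v).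

Definition is_CPS (a : nat -> C) (v : R) (l : C) : Prop :=
  is_pseries (fun m => Re (a m)) v (Re l) /\ is_pseries (fun m => Im (a m)) v (Im l).

Lemma is_CPS_unique a v l l' : is_CPS a v l -> is_CPS a v l' -> l = l'.
Proof.
  intros [H1 H2] [H3 H4]; apply C_eq.
  - apply is_pseries_unique in H1; apply is_pseries_unique in H3; congruence.
  - apply is_pseries_unique in H2; apply is_pseries_unique in H4; congruence.
Qed.

Lemma is_CPS_ext a b v l : (forall m, a m = b m) -> is_CPS a v l -> is_CPS b v l.
Proof.
  intros E [H1 H2]; split; (eapply is_pseries_ext; [|eassumption]);
  intros m; simpl; now rewrite E.
Qed.

Lemma CPS_correct a v : CV_gt1 a -> (0 <= v <= 1)%R -> is_CPS a v (CPS a v).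
Proof.
  intros [H1 H2] Hv; split; apply PSeries_correct, CV_radius_inside;
  (eapply Rbar_le_lt_trans; [|eassumption]); simpl; rewrite Rabs_pos_eq; lra.
Qed.

Definition CPS_deriv (a : nat -> C) (m : nat) : C := INR (S m) * a (S m).

Lemma CPS_deriv_re a : forall m, PS_derive (fun m => Re (a m)) m = Re (CPS_deriv a m).
Proof. intros m. unfold PS_derive, CPS_deriv. now rewrite re_scal_l. Qed.

Lemma CPS_deriv_im a : forall m, PS_derive (fun m => Im (a m)) m = Im (CPS_deriv a m).
Proof. intros m. unfold PS_derive, CPS_deriv. now rewrite im_scal_l. Qed.

Lemma CV_gt1_deriv a : CV_gt1 a -> CV_gt1 (CPS_deriv a).
Proof.
  intros [H1 H2]; split.
  - rewrite <- (CV_radius_ext _ _ (CPS_deriv_re a)), CV_radius_derive. exact H1.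
  - rewrite <- (CV_radius_ext _ _ (CPS_deriv_im a)), CV_radius_derive. exact H2.
Qed.

Lemma is_Cderive_CPS a v :
  CV_gt1 a -> (0 <= v <= 1)%R -> is_Cderive (CPS a) v (CPS (CPS_deriv a) v).
Proof.
  intros [H1 H2] Hv.
  assert (L : forall x, Rbar_lt 1 x -> Rbar_lt (Rabs v) x).
  { intros x. apply Rbar_le_lt_trans. simpl. rewrite Rabs_pos_eq; lra. }
  split; simpl.
  - rewrite <- (PSeries_ext _ _ _ (CPS_deriv_re a)). now apply (is_derive_PSeries _ _ (L _ H1)).
  - rewrite <- (PSeries_ext _ _ _ (CPS_deriv_im a)). now apply (is_derive_PSeries _ _ (L _ H2)).
Qed.

Lemma is_CPS_plus a b v l m :
  is_CPS a v l -> is_CPS b v m -> is_CPS (fun k => a k + b k) v (l + m).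
Proof.
  intros [H1 H2] [H3 H4]; split; simpl.
  - exact (is_pseries_plus _ _ _ _ _ H1 H3).
  - exact (is_pseries_plus _ _ _ _ _ H2 H4).
Qed.

Lemma is_CPS_scal (c : C) a v l :
  is_CPS a v l -> is_CPS (fun k => c * a k) v (c * l).
Proof.
  intros [H1 H2].
  pose proof (fun (d : R) => is_pseries_scal d _ _ _ (Rmult_comm v d) H1) as S1.
  pose proof (fun (d : R) => is_pseries_scal d _ _ _ (Rmult_comm v d) H2) as S2.
  split.
  - rewrite re_mult. unfold Rminus. rewrite Ropp_mult_distr_l.
    eapply is_pseries_ext; [|exact (is_pseries_plus _ _ _ _ _ (S1 (Re c)) (S2 (- Im c)%R))].
    intros n. unfold PS_plus, PS_scal, scal, plus; simpl; unfold mult; simpl.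
    unfold Re, Im; ring.
  - rewrite im_mult, Rplus_comm.
    eapply is_pseries_ext; [|exact (is_pseries_plus _ _ _ _ _ (S1 (Im c)) (S2 (Re c)))].
    intros n. unfold PS_plus, PS_scal, scal, plus; simpl; unfold mult; simpl.
    unfold Re, Im; ring.
Qed.

Lemma is_CPS_mult_deriv a v :
  CV_gt1 a -> (0 <= v <= 1)%R ->
  is_CPS (fun k => INR k * a k) v (v * CPS (CPS_deriv a) v).
Proof.
  intros H Hv. destruct (CPS_correct _ _ (CV_gt1_deriv _ H) Hv) as [H1 H2].
  (* Multiplication by v shifts the indices by one; the new coefficient of index 0 is zero, in
     agreement with [INR 0 * a 0]. *)
  apply is_pseries_incr_1 in H1. apply is_pseries_incr_1 in H2.
  split.
  - rewrite re_scal_l. eapply is_pseries_ext; [|exact H1].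
    intros [|n]; [rewrite re_scal_l; symmetry; apply Rmult_0_l|reflexivity].
  - rewrite im_scal_l. eapply is_pseries_ext; [|exact H2].
    intros [|n]; [|reflexivity]. rewrite im_scal_l. symmetry; apply Rmult_0_l.
Qed.

(** This returns from the real parametrization to the complex Gauss series: partial sums split into
    components, and a ball of the complex plane is here a product of two real balls. *)
Lemma is_CPS_1_is_pseries (c : nat -> C) (z l : C) :
  is_CPS (fun k => c k * z ^ k) 1 l -> @is_pseries C_AbsRing C_NormedModule c z l.
Proof.
  intros [H1 H2].
  set (s := fun k => scal (pow_n (K := C_AbsRing) z k) (c k : C_NormedModule)).
  assert (Es : forall k, s k = c k * z ^ k).
  { intros k. unfold s. change (pow_n z k * c k = c k * z ^ k).
    now rewrite Cmult_comm. }
  assert (S1 : is_series (fun k => Re (s k)) (Re l)).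
  { eapply is_series_ext; [|exact H1]. intros k. rewrite Es.
    rewrite pow_n_pow, pow1. unfold scal; simpl; unfold mult; simpl. ring. }
  assert (S2 : is_series (fun k => Im (s k)) (Im l)).
  { eapply is_series_ext; [|exact H2]. intros k. rewrite Es.
    rewrite pow_n_pow, pow1. unfold scal; simpl; unfold mult; simpl. ring. }
  assert (E : forall n, sum_n s n = (sum_n (fun k => Re (s k)) n, sum_n (fun k => Im (s k)) n)).
  { induction n as [|n IH].
    - rewrite !sum_O. now destruct (s O).
    - rewrite !sum_Sn, IH. destruct (s (S n)); reflexivity. }
  unfold is_pseries, is_series. fold s.
  apply filterlim_locally. intros eps.
  eapply filter_imp; [|exact (filter_and _ _ (proj1 (filterlim_locally _ _) S1 eps)
    (proj1 (filterlim_locally _ _) S2 eps))].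
  intros n [B1 B2]. rewrite E. destruct l; split; [exact B1|exact B2].
Qed.

(** * Hypergeometric coefficients: convergence and differential equations *)

Lemma pochhammer_neq0 (a : R) m : (0 < a)%R -> pochhammer a m <> 0.
Proof.
  intros Ha. induction m as [|m IH]; simpl; [apply C1_nz|].
  apply Cmult_neq_0; auto. rewrite <- RtoC_plus. apply RtoC_neq0.
  pose proof (pos_INR m); lra.
Qed.

Lemma hyp2F1_coeff_0 a b c : hyp2F1_coeff a b c 0 = 1.
Proof. unfold hyp2F1_coeff. simpl. field. Qed.

(** The ratio of consecutive coefficients is grouped into two fractions that each tend to 1, ready
    for the ratio test. *)
Lemma hyp2F1_coeff_S (a b c : R) m : (0 < c)%R ->
  hyp2F1_coeff a b c (S m) =
  hyp2F1_coeff a b c m * (((a + INR m) / (c + INR m))%R * ((b + INR m) / (1 + INR m))%R).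
Proof.
  intros Hc. pose proof (pos_INR m). unfold hyp2F1_coeff.
  change (fact (S m)) with (S m * fact m)%nat. rewrite mult_INR, S_INR.
  rewrite !RtoC_div, RtoC_mult, !RtoC_plus by lra. simpl pochhammer. field.
  rewrite <- !RtoC_plus.
  repeat split; try (apply RtoC_neq0; try apply INR_fact_neq_0; lra).
  now apply pochhammer_neq0.
Qed.

Lemma hyp2F1_coeff_neq0 (a b c : R) m : (0 < a)%R -> (0 < b)%R -> (0 < c)%R ->
  hyp2F1_coeff a b c m <> 0.
Proof.
  intros Ha Hb Hc. induction m as [|m IH]; [rewrite hyp2F1_coeff_0; apply C1_nz|].
  pose proof (pos_INR m).
  rewrite hyp2F1_coeff_S by assumption. apply Cmult_neq_0; auto.
  rewrite <- RtoC_mult. apply RtoC_neq0. apply Rmult_integral_contrapositive; split;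
  apply Rmult_integral_contrapositive; split; try apply Rinv_neq_0_compat; lra.
Qed.

Lemma is_lim_seq_ratio (p q : R) : (0 < q)%R ->
  is_lim_seq (fun m => ((p + INR m) / (q + INR m))%R) 1.
Proof.
  intros Hq.
  assert (L : is_lim_seq (fun m => / (q + INR m))%R 0).
  { replace (Finite 0) with (Rbar_inv p_infty) by reflexivity.
    apply is_lim_seq_inv; [|discriminate].
    eapply is_lim_seq_plus; [apply is_lim_seq_const|apply is_lim_seq_INR|reflexivity]. }
  apply (is_lim_seq_ext (fun m => 1 + (p - q) * / (q + INR m))%R).
  - intros m. pose proof (pos_INR m). field. lra.
  - replace (Finite 1) with (Finite (1 + (p - q) * 0)%R) by (f_equal; ring).
    apply is_lim_seq_plus'; [apply is_lim_seq_const|].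
    apply is_lim_seq_mult'; [apply is_lim_seq_const|exact L].
Qed.

Lemma CV_gt1_hyp2F1 (a b c : R) (z : C) :
  (0 < a)%R -> (0 < b)%R -> (0 < c)%R -> (Cmod z < 1)%R -> z <> 0 ->
  CV_gt1 (fun m => hyp2F1_coeff a b c m * z ^ m).
Proof.
  intros Ha Hb Hc Hz Hz0. apply (CV_gt1_ratio _ (1 * 1 * Cmod z)%R).
  - intros m. apply Cmult_neq_0; [now apply hyp2F1_coeff_neq0|now apply Cpow_nz].
  - pose proof (proj1 (Cmod_gt_0 z) Hz0). lra.
  - eapply is_lim_seq_ext; [|apply is_lim_seq_mult';
      [apply is_lim_seq_mult'; [apply (is_lim_seq_ratio a c Hc)|apply (is_lim_seq_ratio b 1 Rlt_0_1)]|
       apply is_lim_seq_const]].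
    intros m. pose proof (pos_INR m). cbv beta.
    rewrite hyp2F1_coeff_S, Cpow_S by assumption.
    set (x := ((a + INR m) / (c + INR m))%R). set (y := ((b + INR m) / (1 + INR m))%R).
    replace (_ / _) with (RtoC (x * y) * z).
    + rewrite Cmod_mult, Cmod_R, Rabs_pos_eq; [reflexivity|].
      apply Rmult_le_pos; apply Rmult_le_pos; try apply Rlt_le, Rinv_0_lt_compat; lra.
    + rewrite RtoC_mult. field. split; [now apply Cpow_nz|now apply hyp2F1_coeff_neq0].
Qed.

Section Series.
Variables (al be : R) (z : C).
Hypotheses (Hal : (0 < al)%R) (Hbe : (0 < be)%R) (Hz : (Cmod z < 1)%R) (Hz0 : z <> 0).

Let h m := hyp2F1_coeff be al (be + 1) m * z ^ m.
(** The parameters 1 and 1 cancel, which leaves the binomial series of (1 - z v)^(-al). *)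
Let g m := hyp2F1_coeff al 1 1 m * z ^ m.

(** The operator be + v d/dv multiplies the coefficient of index m by be + m, and (be + m) (be)_m /
    (be + 1)_m = be. This removes the lower parameter and leaves the binomial series. *)
Lemma hyp2F1_contiguous (v : R) : (0 <= v <= 1)%R ->
  be * CPS h v + v * CPS (CPS_deriv h) v = be * CPS g v.
Proof.
  intros Hv.
  assert (Kh : CV_gt1 h).
  { unfold h. rewrite <- RtoC_plus. apply CV_gt1_hyp2F1; auto; lra. }
  assert (Kg : CV_gt1 g) by (apply CV_gt1_hyp2F1; auto; lra).
  eapply is_CPS_unique; [|apply is_CPS_scal, (CPS_correct _ _ Kg Hv)].
  eapply is_CPS_ext; [|apply is_CPS_plus;
    [apply is_CPS_scal, (CPS_correct _ _ Kh Hv)|apply (is_CPS_mult_deriv _ _ Kh Hv)]].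
  intros m. unfold h, g. cbv beta.
  transitivity ((be + INR m) * hyp2F1_coeff be al (be + 1)%R m * z ^ m);
    [rewrite RtoC_plus; ring|].
  rewrite Cmult_assoc. f_equal.
  induction m as [|m IH]; [rewrite !hyp2F1_coeff_0; simpl; ring|].
  rewrite !hyp2F1_coeff_S by lra.
  transitivity ((be + INR m) * hyp2F1_coeff be al (be + 1)%R m * ((al + INR m) / (1 + INR m))%R).
  - pose proof (pos_INR m). rewrite S_INR, !RtoC_div, !RtoC_plus by lra. field.
    cbv beta; rewrite <- !RtoC_plus. split; apply RtoC_neq0; lra.
  - rewrite IH. pose proof (pos_INR m). rewrite !RtoC_div, !RtoC_plus by lra. field.
    cbv beta; rewrite <- !RtoC_plus. apply RtoC_neq0; lra.
Qed.

(** Coefficientwise this is (m + 1) g_(m+1) = z (al + m) g_m. *)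
Lemma binomial_series_ode (v : R) : (0 <= v <= 1)%R ->
  CPS (CPS_deriv g) v = z * (al * CPS g v + v * CPS (CPS_deriv g) v).
Proof.
  intros Hv.
  assert (Kg : CV_gt1 g) by (apply CV_gt1_hyp2F1; auto; lra).
  eapply is_CPS_unique; [apply CPS_correct; auto; now apply CV_gt1_deriv|].
  eapply is_CPS_ext; [|apply is_CPS_scal, is_CPS_plus;
    [apply is_CPS_scal, (CPS_correct _ _ Kg Hv)|apply (is_CPS_mult_deriv _ _ Kg Hv)]].
  intros m. unfold CPS_deriv, g. rewrite hyp2F1_coeff_S, Cpow_S by lra.
  pose proof (pos_INR m). rewrite S_INR, !RtoC_div, !RtoC_plus by lra. field.
  cbv beta; rewrite <- !RtoC_plus. apply RtoC_neq0; lra.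
Qed.
End Series.

Lemma CPS_at_0 a : CPS a 0 = a O.
Proof. unfold CPS. rewrite !PSeries_0. now destruct (a O). Qed.

(** * Principal branches *)

Lemma Cmod_polar (z : C) : z <> 0 ->
  (Cmod z * cos (acos (Re z / Cmod z)) = Re z)%R /\
  (Cmod z * sin (acos (Re z / Cmod z)) = Rabs (Im z))%R.
Proof.
  intros Hz. pose proof (proj1 (Cmod_gt_0 z) Hz) as Hm.
  assert (Hb : (-1 <= Re z / Cmod z <= 1)%R).
  { assert (E := re_le_Cmod z). apply Rabs_le_between in E.
    split; [apply Rle_div_r|apply Rle_div_l]; lra. }
  rewrite cos_acos, sin_acos by assumption. split; [field; lra|].
  rewrite <- (sqrt_Rsqr (Cmod z)) at 1 by lra.
  rewrite <- sqrt_mult; [|apply Rle_0_sqr|unfold Rsqr; nra].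
  rewrite <- sqrt_Rsqr_abs. f_equal.
  assert (E := Cmod2_alt z). unfold Rsqr.
  transitivity (Cmod z ^ 2 - Re z ^ 2)%R; [field; lra|rewrite E; ring].
Qed.

Lemma Cexp_Clog (z : C) : z <> 0 -> Cexp (Clog z) = z.
Proof.
  intros Hz. pose proof (proj1 (Cmod_gt_0 z) Hz) as Hm.
  destruct (Cmod_polar z Hz) as [E1 E2].
  unfold Cexp, Clog, Carg. cbn [Re Im fst snd]. rewrite exp_ln by assumption.
  destruct (Rle_dec 0 (Im z)) as [H|H].
  - rewrite Rabs_pos_eq in E2 by assumption. apply C_eq; [exact E1|exact E2].
  - rewrite Rabs_left in E2 by lra. apply C_eq; unfold Re, Im in *; simpl.
    + now rewrite cos_neg.
    + rewrite sin_neg. lra.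
Qed.

Lemma Carg_bound (z : C) : z <> 0 -> (- PI < Carg z <= PI)%R.
Proof.
  intros Hz. pose proof (proj1 (Cmod_gt_0 z) Hz) as Hm.
  destruct (Cmod_polar z Hz) as [E1 E2].
  pose proof (acos_bound (Re z / Cmod z)) as B. pose proof PI_RGT_0.
  unfold Carg. destruct (Rle_dec 0 (Im z)) as [H0|H0]; [lra|].
  split; [|lra].
  (* An angle equal to [PI] would have sine 0 and force a zero imaginary part, whereas it is
     negative in this case. *)
  destruct (proj2 B) as [L|L]; [lra|].
  rewrite L, sin_PI, Rabs_left in E2; lra.
Qed.

Lemma Clog_Cexp (w : C) : (- PI / 2 < Im w < PI / 2)%R -> Clog (Cexp w) = w.
Proof.
  destruct w as [x y]; simpl; intros Hy.
  assert (Em : Cmod (Cexp (x, y)) = exp x).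
  { unfold Cmod, Cexp; simpl. pose proof (exp_pos x) as He.
    transitivity (sqrt (exp x)²); [f_equal|apply sqrt_Rsqr; lra].
    transitivity ((exp x)² * ((sin y)² + (cos y)²))%R; [unfold Rsqr; ring|].
    rewrite sin2_cos2. ring. }
  unfold Clog. rewrite Em, ln_exp. apply C_eq; [reflexivity|]. cbn [Im snd].
  unfold Carg. rewrite Em. unfold Cexp; cbn [Re Im fst snd].
  pose proof (exp_pos x) as He. pose proof PI_RGT_0.
  replace (exp x * cos y / exp x)%R with (cos y) by (field; lra).
  destruct (Rle_dec 0 (exp x * sin y)) as [H1|H1].
  - apply acos_cos. split; [|lra].
    destruct (Rle_lt_dec 0 y) as [|Hneg]; [assumption|].
    assert (sin y < 0)%R by (apply sin_lt_0_var; lra). nra.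
  - rewrite <- cos_neg, acos_cos; [lra|]. split; [|lra].
    destruct (Rle_lt_dec y 0) as [|Hpos]; [lra|].
    assert (0 < sin y)%R by (apply sin_gt_0; lra). nra.
Qed.

Lemma Csqrt_Cexp (z : C) : z <> 0 -> Csqrt z = Cexp (Clog z / 2).
Proof.
  intros Hz. pose proof (proj1 (Cmod_gt_0 z) Hz) as Hm.
  assert (E : sqrt (Cmod z) = exp (ln (Cmod z) / 2)).
  { rewrite <- Rpower_sqrt by assumption. unfold Rpower. f_equal. lra. }
  unfold Csqrt. rewrite E.
  replace (RtoC (exp (ln (Cmod z) / 2))) with (Cexp (ln (Cmod z) / 2)%R).
  - rewrite <- Cexp_plus. f_equal. unfold Clog. apply C_eq; simpl; field.
  - apply C_eq; unfold Cexp; simpl; rewrite ?cos_0, ?sin_0; ring.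
Qed.

Lemma Csqrt_sqr (z : C) : z <> 0 -> Csqrt z * Csqrt z = z.
Proof.
  intros Hz. rewrite Csqrt_Cexp, <- Cexp_plus by assumption.
  rewrite <- (Cexp_Clog z Hz) at 3. f_equal. field.
Qed.

(** The image of the principal square root; of two opposite nonzero numbers it contains exactly
    one. *)
Definition Csqrt_range (y : C) : Prop := (0 < Re y)%R \/ (Re y = 0%R /\ (0 <= Im y)%R).

Lemma Csqrt_in_range (z : C) : z <> 0 -> Csqrt_range (Csqrt z).
Proof.
  intros Hz. rewrite Csqrt_Cexp by assumption.
  pose proof (Carg_bound z Hz) as B. unfold Csqrt_range, Cexp, Re, Im; cbn [fst snd].
  replace (snd (Clog z / 2)) with (Carg z / 2)%R by (unfold Clog; simpl; field).
  set (e := exp _). assert (He : (0 < e)%R) by apply exp_pos.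
  destruct (proj2 B) as [L|L].
  - left. apply Rmult_lt_0_compat; [assumption|]. apply cos_gt_0; lra.
  - right. rewrite L, cos_PI2, sin_PI2. lra.
Qed.

(** The root s of [y * y] is y or -y. In the second case y and -y both lie in the range, which
    forces y = 0. *)
Lemma Csqrt_unique (y : C) : Csqrt_range y -> Csqrt (y * y) = y.
Proof.
  intros Hy. destruct (Ceq_dec y 0) as [->|H0].
  - rewrite Cmult_0_l. unfold Csqrt. rewrite Cmod_0, sqrt_0. ring.
  - assert (H2 : y * y <> 0) by now apply Cmult_neq_0.
    pose proof (Csqrt_sqr _ H2) as E. pose proof (Csqrt_in_range _ H2) as Hs.
    set (s := Csqrt (y * y)) in *.
    destruct (Ceq_dec (s - y) 0) as [D|D]; [now apply Ceq_minus|].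
    exfalso. apply H0.
    assert (S : s + y = 0).
    { destruct (Ceq_dec (s + y) 0) as [|D']; [assumption|]. exfalso.
      apply (Cmult_neq_0 _ _ D D').
      transitivity (s * s - y * y); [ring|rewrite E; ring]. }
    assert (Er : (Re s + Re y = 0)%R) by (rewrite <- re_plus, S; reflexivity).
    assert (Ei : (Im s + Im y = 0)%R) by (rewrite <- im_plus, S; reflexivity).
    unfold Csqrt_range in *.
    apply C_eq; simpl; lra.
Qed.

Lemma Cpower_half (z : C) n : z <> 0 ->
  Cpower z (INR n + 1 / 2) = Csqrt z ^ (1 + 2 * n).
Proof.
  intros Hz. rewrite Csqrt_Cexp, <- Cexp_INR by assumption. unfold Cpower. f_equal.
  rewrite plus_INR, mult_INR, RtoC_plus, RtoC_mult.
  change (INR 2) with 2%R. change (INR 1) with 1%R. field.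
Qed.

(** * The complex arctangent on the unit disc and its link with the principal arcsine *)

Definition Carctan (s : C) : C :=
  (Clog_rhp (1 + Ci * s) - Clog_rhp (1 - Ci * s)) / (2 * Ci).

(* The cosine of [Carctan s]: the square root of [1 / (1 + s ^ 2)] in the right half-plane. *)
Definition cos_arctan (s : C) : C :=
  Cexp (- ((Clog_rhp (1 + Ci * s) + Clog_rhp (1 - Ci * s)) / 2)).

Section Arctan.
Variable s : C.
Hypothesis Hs : (Cmod s < 1)%R.

(** Since |Im s| <= |s| < 1, the point stays in the half-plane where [Clog_rhp] is smooth and is a
    right inverse of the exponential. *)
Lemma re_1_plus_Ci : (0 < Re (1 + Ci * s))%R.
Proof.
  assert (E : (Rabs (Im s) <= Cmod s)%R)
    by (eapply Rle_trans; [apply Rmax_r|apply Rmax_Cmod]).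
  apply Rabs_le_between in E. destruct s; simpl in *; lra.
Qed.

Lemma re_1_minus_Ci : (0 < Re (1 - Ci * s))%R.
Proof.
  assert (E : (Rabs (Im s) <= Cmod s)%R)
    by (eapply Rle_trans; [apply Rmax_r|apply Rmax_Cmod]).
  apply Rabs_le_between in E. destruct s; simpl in *; lra.
Qed.

Lemma cos_arctan_sqr : cos_arctan s * cos_arctan s * (1 + s * s) = 1.
Proof.
  unfold cos_arctan. rewrite <- Cexp_plus.
  replace (1 + s * s) with ((1 + Ci * s) * (1 - Ci * s))
    by (transitivity (1 - (Ci * Ci) * (s * s)); [ring|rewrite Ci_sqr; ring]).
  rewrite <- (Cexp_Clog_rhp _ re_1_plus_Ci) at 3.
  rewrite <- (Cexp_Clog_rhp _ re_1_minus_Ci) at 3.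
  rewrite <- !Cexp_plus, <- Cexp_0. f_equal. field.
Qed.

(** With L and M the logarithms of 1 + is and 1 - is, this is (L - M)/2 = L - (L + M)/2 under the
    exponential. *)
Lemma Cexp_Carctan : Cexp (Ci * Carctan s) = (1 + Ci * s) * cos_arctan s.
Proof.
  unfold cos_arctan.
  rewrite <- (Cexp_Clog_rhp _ re_1_plus_Ci) at 1. rewrite <- Cexp_plus. f_equal.
  unfold Carctan. field. apply Ci_nz.
Qed.

Lemma Cexp_opp_Carctan : Cexp (- (Ci * Carctan s)) = (1 - Ci * s) * cos_arctan s.
Proof.
  unfold cos_arctan.
  rewrite <- (Cexp_Clog_rhp _ re_1_minus_Ci) at 1. rewrite <- Cexp_plus. f_equal.
  unfold Carctan. field. apply Ci_nz.
Qed.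

Lemma Csin_Carctan : Csin (Carctan s) = s * cos_arctan s.
Proof.
  unfold Csin. rewrite Cexp_Carctan, Cexp_opp_Carctan. field. apply Ci_nz.
Qed.

Lemma im_Clog_rhp (w : C) : (- PI / 2 < Im (Clog_rhp w) < PI / 2)%R.
Proof. pose proof (atan_bound (Im w / Re w)). simpl. lra. Qed.

(** Up to sign, the argument is the mean of two angles in the open interval from -PI/2 to PI/2, so
    its cosine is positive. *)
Lemma re_cos_arctan : (0 < Re (cos_arctan s))%R.
Proof.
  unfold cos_arctan, Cexp, Re. cbn [fst].
  apply Rmult_lt_0_compat; [apply exp_pos|].
  assert (B1 := im_Clog_rhp (1 + Ci * s)). assert (B2 := im_Clog_rhp (1 - Ci * s)).
  replace (Im (- ((Clog_rhp (1 + Ci * s) + Clog_rhp (1 - Ci * s)) / 2))) with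
    (- (Im (Clog_rhp (1 + Ci * s)) + Im (Clog_rhp (1 - Ci * s))) / 2)%R
    by (destruct (Clog_rhp (1 + Ci * s)), (Clog_rhp (1 - Ci * s)); simpl; field).
  apply cos_gt_0; lra.
Qed.

Lemma re_Carctan :
  Re (Carctan s) = ((Im (Clog_rhp (1 + Ci * s)) - Im (Clog_rhp (1 - Ci * s))) / 2)%R.
Proof.
  unfold Carctan. rewrite Cdiv_2Ci.
  destruct (Clog_rhp (1 + Ci * s)), (Clog_rhp (1 - Ci * s)); simpl; field.
Qed.

(** Positivity of its real part identifies [cos_arctan s] as the principal root of 1 - sin^2. The
    logarithm is then taken at exp(i [Carctan s]), and it inverts the exponential because the real
    part of [Carctan s] lies strictly between -PI/2 and PI/2. *)
Lemma Carcsin_Csin_Carctan : Carcsin (Csin (Carctan s)) = Carctan s.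
Proof.
  unfold Carcsin.
  replace (1 - Csin (Carctan s) * Csin (Carctan s)) with (cos_arctan s * cos_arctan s).
  - rewrite Csqrt_unique by (left; apply re_cos_arctan).
    replace (Ci * Csin (Carctan s) + cos_arctan s) with (Cexp (Ci * Carctan s))
      by (rewrite Cexp_Carctan, Csin_Carctan; ring).
    rewrite Clog_Cexp.
    + transitivity (- (Ci * Ci) * Carctan s); [ring|]. rewrite Ci_sqr. ring.
    + rewrite Cmult_comm.
      replace (Im (Carctan s * Ci)) with (Re (Carctan s)) by (destruct (Carctan s); simpl; ring).
      rewrite re_Carctan.
      assert (B1 := im_Clog_rhp (1 + Ci * s)). assert (B2 := im_Clog_rhp (1 - Ci * s)). lra.
  - rewrite Csin_Carctan.
    transitivity (cos_arctan s * cos_arctan s * (1 + s * s) - s * s * (cos_arctan s * cos_arctan s)); [ring|].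
    rewrite cos_arctan_sqr. ring.
Qed.

End Arctan.

(** If Re s > 0, the arguments of 1 + is and 1 - is have opposite signs, so x = Re([Carctan s]) lies
    between 0 and PI/2 and the real part sin(x) cosh(y) of the sine is positive. If Re s = 0, both
    points are real, the cosine is a positive real, and the sine stays on the upper imaginary
    half-axis. *)
Lemma Csin_Carctan_range (s : C) :
  (Cmod s < 1)%R -> Csqrt_range s -> Csqrt_range (Csin (Carctan s)).
Proof.
  intros Hs. assert (P := re_1_plus_Ci s Hs). assert (M := re_1_minus_Ci s Hs).
  intros [Ha|[Ha Hb]].
  - left.
    assert (B1 := im_Clog_rhp (1 + Ci * s)). assert (B2 := im_Clog_rhp (1 - Ci * s)).
    assert (S1 : Im (1 + Ci * s) = Re s) by (simpl; unfold Re; ring).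
    assert (S2 : Im (1 - Ci * s) = (- Re s)%R) by (simpl; unfold Re; ring).
    assert (I1 : (0 < Im (Clog_rhp (1 + Ci * s)))%R).
    { change (0 < atan (Im (1 + Ci * s) / Re (1 + Ci * s)))%R.
      rewrite <- atan_0, S1. apply atan_increasing, Rdiv_lt_0_compat; assumption. }
    assert (I2 : (Im (Clog_rhp (1 - Ci * s)) < 0)%R).
    { change (atan (Im (1 - Ci * s) / Re (1 - Ci * s)) < 0)%R.
      rewrite <- atan_0, S2. apply atan_increasing. rewrite Ropp_div.
      apply Ropp_lt_gt_0_contravar, Rdiv_lt_0_compat; assumption. }
    assert (Hx := re_Carctan s). set (x := Carctan s) in *.
    replace (Re (Csin x)) with (sin (Re x) * ((exp (Im x) + exp (- Im x)) / 2))%R.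
    + assert (0 < sin (Re x))%R by (apply sin_gt_0; lra).
      pose proof (exp_pos (Im x)). pose proof (exp_pos (- Im x)).
      apply Rmult_lt_0_compat; lra.
    + unfold Csin. rewrite Cdiv_2Ci. destruct x as [x y]; unfold Cexp; simpl.
      replace (0 * x - 1 * y)%R with (- y)%R by ring.
      replace (0 * y + 1 * x)%R with x by ring. rewrite Ropp_involutive, cos_neg, sin_neg. field.
  - right. rewrite Csin_Carctan by assumption.
    destruct s as [a b]; simpl in Ha, Hb; subst a.
    assert (E : Im (cos_arctan (0%R, b)) = 0%R).
    { unfold cos_arctan, Cexp, Clog_rhp; simpl.
      match goal with |- (_ * sin ?e = 0)%R => replace e with 0%R end.
      - rewrite sin_0; ring.
      - replace (0 + (0 * b + 1 * 0))%R with 0%R by ring.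
        replace (0 + - (0 * b + 1 * 0))%R with 0%R by ring.
        unfold Rdiv; rewrite !Rmult_0_l, atan_0. field. }
    assert (Q := re_cos_arctan (0%R, b)).
    destruct (cos_arctan (0%R, b)) as [p q]; simpl in *; subst q. split; [ring|].
    assert (X := Rmult_le_pos _ _ Hb (Rlt_le _ _ Q)). lra.
Qed.

Lemma Cmod_Csqrt_opp_lt1 (z : C) : (Cmod z < 1)%R -> z <> 0 -> (Cmod (Csqrt (- z)) < 1)%R.
Proof.
  intros Hz H0.
  assert (H0' : - z <> 0) by (intros E; apply H0; rewrite <- (Copp_0), <- E; ring).
  assert (E := f_equal Cmod (Csqrt_sqr _ H0')). rewrite Cmod_mult, Cmod_opp in E.
  pose proof (Cmod_ge_0 (Csqrt (- z))). nra.
Qed.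

(** For t the principal root of -z, the square of sin(arctan t) is t^2 / (1 + t^2) = z / (z - 1);
    this sine also lies in the range of the principal root, which fixes its sign. *)
Lemma Carcsin_Csqrt (z : C) : (Cmod z < 1)%R -> z <> 0 ->
  Carcsin (Csqrt (z / (z - 1))) = Carctan (Csqrt (- z)).
Proof.
  intros Hz H0.
  assert (H0' : - z <> 0) by (intros E; apply H0; rewrite <- (Copp_0), <- E; ring).
  assert (H1 : z - 1 <> 0).
  { intros E. apply Ceq_minus in E. rewrite E, Cmod_1 in Hz. lra. }
  pose proof (Csqrt_sqr _ H0') as Et. pose proof (Csqrt_in_range _ H0') as Hr.
  pose proof (Cmod_Csqrt_opp_lt1 z Hz H0) as Ht.
  set (t := Csqrt (- z)) in *.
  rewrite <- (Carcsin_Csin_Carctan t Ht). f_equal.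
  rewrite <- (Csqrt_unique (Csin (Carctan t))) by now apply Csin_Carctan_range.
  f_equal. rewrite Csin_Carctan by assumption.
  assert (K := cos_arctan_sqr t Ht). rewrite Et in K.
  transitivity (t * t * (cos_arctan t * cos_arctan t)); [|ring]. rewrite Et.
  set (k := cos_arctan t * cos_arctan t) in *.
  transitivity (z / (z - 1) * (k * (1 + - z))); [rewrite K; field; assumption|].
  field. assumption.
Qed.

(** * Integration along the ray *)

Lemma Carctan_0 : Carctan 0 = 0.
Proof.
  unfold Carctan. replace (1 - Ci * 0) with (1 + Ci * 0) by ring. field. apply Ci_nz.
Qed.

Lemma cos_arctan_0 : cos_arctan 0 = 1.
Proof.
  unfold cos_arctan. transitivity (Cexp 0); [f_equal|apply Cexp_0].
  replace (1 - Ci * 0) with (RtoC 1) by ring. replace (1 + Ci * 0) with (RtoC 1) by ring.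
  assert (E : Clog_rhp 1 = 0).
  { unfold Clog_rhp; apply C_eq; simpl.
    - replace (1 * (1 * 1) + 0 * (0 * 1))%R with 1%R by ring. rewrite ln_1. field.
    - unfold Rdiv. now rewrite Rmult_0_l, atan_0. }
  rewrite E. field.
Qed.

Section Ray.
Variables (t : C) (u : R).
Hypotheses (Ht : (Cmod t < 1)%R) (Hu : (0 <= u <= 1)%R).

Lemma Cmod_ray : (Cmod (u * t) < 1)%R.
Proof.
  rewrite Cmod_mult, Cmod_R, Rabs_pos_eq by lra. pose proof (Cmod_ge_0 t). nra.
Qed.

Lemma is_Cderive_Clog_rhp_ray :
  is_Cderive (fun v => Clog_rhp (1 + Ci * (v * t))) u (Ci * t / (1 + Ci * (u * t))) /\
  is_Cderive (fun v => Clog_rhp (1 - Ci * (v * t))) u (- (Ci * t) / (1 - Ci * (u * t))).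
Proof.
  assert (D : is_Cderive (fun v => Ci * (v * t)) u (Ci * t)).
  { eapply is_Cderive_ext, is_Cderive_val; [|apply (is_Cderive_scal (Ci * t)), is_Cderive_id|];
    intros; cbv beta; ring. }
  split; apply is_Cderive_Clog_rhp.
  - eapply is_Cderive_val; [apply is_Cderive_plus; [apply is_Cderive_const|exact D]|ring].
  - apply re_1_plus_Ci, Cmod_ray.
  - eapply is_Cderive_val; [apply is_Cderive_minus; [apply is_Cderive_const|exact D]|ring].
  - apply re_1_minus_Ci, Cmod_ray.
Qed.

Lemma ray_neq0 : 1 + Ci * (u * t) <> 0 /\ 1 - Ci * (u * t) <> 0.
Proof.
  pose proof (re_1_plus_Ci _ Cmod_ray) as P. pose proof (re_1_minus_Ci _ Cmod_ray) as M.
  split; intros E; rewrite E in *; simpl in *; lra.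
Qed.

Lemma is_Cderive_Carctan_ray :
  is_Cderive (fun v => Carctan (v * t)) u (t * (cos_arctan (u * t) * cos_arctan (u * t))).
Proof.
  destruct is_Cderive_Clog_rhp_ray as [D1 D2]. destruct ray_neq0 as [P M].
  eapply is_Cderive_ext, is_Cderive_val;
    [|apply (is_Cderive_scal (/ (2 * Ci))), (is_Cderive_minus _ _ _ _ _ D1 D2)|].
  - intros v. apply Cmult_comm.
  - set (k := cos_arctan (u * t)).
    assert (E := cos_arctan_sqr _ Cmod_ray). fold k in E.
    replace (1 + u * t * (u * t)) with ((1 + Ci * (u * t)) * (1 - Ci * (u * t))) in E
      by (transitivity (1 - (Ci * Ci) * (u * t * (u * t))); [ring|rewrite Ci_sqr; ring]).
    transitivity (t * (k * k * ((1 + Ci * (u * t)) * (1 - Ci * (u * t)))) /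
      ((1 + Ci * (u * t)) * (1 - Ci * (u * t)))).
    + rewrite E. field. repeat split; assumption || apply Ci_nz.
    + field. repeat split; assumption.
Qed.

(** The reciprocal of the cosine is the root of 1 + u^2 t^2, with derivative u t^2 over that root.
    As an exponential it is differentiated without a quotient rule. *)
Lemma is_Cderive_inv_cos_arctan_ray :
  is_Cderive (fun v => / cos_arctan (v * t)) u (u * (t * t) * cos_arctan (u * t)).
Proof.
  destruct is_Cderive_Clog_rhp_ray as [D1 D2]. destruct ray_neq0 as [P M].
  eapply is_Cderive_ext, is_Cderive_val;
    [|apply is_Cderive_exp, (is_Cderive_scal (/ 2)), (is_Cderive_plus _ _ _ _ _ D1 D2)|].
  - intros v. cbv beta. unfold cos_arctan. rewrite <- Cexp_opp. f_equal. field.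
  - cbv beta. set (k := cos_arctan (u * t)).
    assert (Hk : k <> 0) by apply Cexp_neq0.
    replace (Cexp _) with (/ k)
      by (unfold k, cos_arctan; rewrite <- Cexp_opp; f_equal; field).
    assert (E := cos_arctan_sqr _ Cmod_ray). fold k in E.
    replace (1 + u * t * (u * t)) with ((1 + Ci * (u * t)) * (1 - Ci * (u * t))) in E
      by (transitivity (1 - (Ci * Ci) * (u * t * (u * t))); [ring|rewrite Ci_sqr; ring]).
    transitivity (/ k * (- (Ci * Ci) * (u * (t * t)) / ((1 + Ci * (u * t)) * (1 - Ci * (u * t))))).
    + field. repeat split; assumption.
    + rewrite Ci_sqr.
      transitivity (u * (t * t) / k * ((k * k * ((1 + Ci * (u * t)) * (1 - Ci * (u * t)))) /
        ((1 + Ci * (u * t)) * (1 - Ci * (u * t))))).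
      * rewrite E. field. repeat split; assumption.
      * field. repeat split; assumption.
Qed.
End Ray.

Lemma is_Cderive_CPS_sqr a u :
  CV_gt1 a -> (0 <= u <= 1)%R ->
  is_Cderive (fun v => CPS a (v ^ 2)) u (2 * u * CPS (CPS_deriv a) (u ^ 2)%R).
Proof.
  intros Ha Hu. eapply is_Cderive_val.
  - apply (is_Cderive_comp_real (CPS a) (fun v => v ^ 2)%R); [apply is_Cderive_CPS; auto; nra|].
    auto_derive; [trivial|reflexivity].
  - rewrite !RtoC_mult. simpl INR. replace (1 + 1)%R with 2%R by ring.
    replace (RtoC (u ^ 1)) with (RtoC u) by (f_equal; ring). ring.
Qed.

(** * The series and the primitive of the sine power compared along the ray *)

Section Main.
Variables (N : nat) (z t : C).
Hypotheses (Hz : (Cmod z < 1)%R) (Hz0 : z <> 0) (Htz : t * t = - z) (Ht : (Cmod t < 1)%R).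

Let al := ((INR N + 2) / 2)%R.
Let be := ((INR N + 1) / 2)%R.
Let h m := hyp2F1_coeff be al (be + 1) m * z ^ m.
Let g m := hyp2F1_coeff al 1 1 m * z ^ m.

Lemma al_be_pos : (0 < al)%R /\ (0 < be)%R.
Proof. unfold al, be. pose proof (pos_INR N). lra. Qed.

Lemma CV_gt1_h : CV_gt1 h.
Proof.
  destruct al_be_pos. unfold h. rewrite <- RtoC_plus. apply CV_gt1_hyp2F1; auto; lra.
Qed.

Lemma CV_gt1_g : CV_gt1 g.
Proof. destruct al_be_pos. unfold g. apply CV_gt1_hyp2F1; auto; lra. Qed.

Lemma binomial_series_ray (u : R) : (0 <= u <= 1)%R ->
  CPS g (u ^ 2) = cos_arctan (u * t) ^ (2 + N).
Proof.
  intros Hu.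
  (* The quotient of the two sides is shown to be constant; it equals 1 at v = 0. *)
  set (W := fun v : R => CPS g (v ^ 2) * (/ cos_arctan (v * t)) ^ (2 + N)).
  assert (W0 : W 0%R = 1).
  { unfold W. rewrite pow_i, CPS_at_0, Cmult_0_l, cos_arctan_0 by lia.
    unfold g. rewrite hyp2F1_coeff_0. replace (/ RtoC 1) with (RtoC 1) by field.
    rewrite Cpow_1_l. simpl. ring. }
  assert (DW : forall v, (0 <= v <= 1)%R -> is_Cderive W v 0).
  { intros v Hv. eapply is_Cderive_val.
    - apply is_Cderive_mult; [apply is_Cderive_CPS_sqr; [exact CV_gt1_g|exact Hv]|].
      eapply (is_Cderive_pow (fun v => / cos_arctan (v * t)) v _ (S N)), is_Cderive_inv_cos_arctan_ray; assumption.
    - cbv beta. destruct al_be_pos as [Pa Pb].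
      assert (Hv2 : (0 <= v ^ 2 <= 1)%R) by nra.
      assert (O := binomial_series_ode al z Pa Hz Hz0 _ Hv2). fold g in O.
      assert (K := cos_arctan_sqr _ (Cmod_ray t v Ht Hv)).
      set (k := cos_arctan (v * t)) in *.
      assert (Hk : k <> 0) by apply Cexp_neq0.
      rewrite Htz. replace (v * t * (v * t)) with (- (RtoC (v ^ 2)) * z) in K
        by (rewrite RtoC_pow; transitivity (v * v * (t * t)); [rewrite Htz; simpl; ring|ring]).
      set (G := CPS g (v ^ 2)) in *. set (G' := CPS (CPS_deriv g) (v ^ 2)) in *.
      change (2 + N)%nat with (S (S N)). rewrite (Cpow_S (/ k) (S N)).
      assert (A : 2 * RtoC al = INR (S (S N))).
      { unfold al. rewrite !S_INR, <- RtoC_mult. f_equal. field. }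
      rewrite <- A.
      transitivity (2 * v * (/ k) ^ S N * k * (G' * / (k * k) - al * z * G)); [field; exact Hk|].
      (* From 1/cos^2 = 1 + v^2 t^2 and t^2 = -z, the remaining factor becomes exactly the
         differential equation of the binomial series. *)
      replace (/ (k * k)) with (1 + - RtoC (v ^ 2) * z).
      + transitivity (2 * v * (/ k) ^ S N * k * (G' - z * (al * G + RtoC (v ^ 2) * G'))); [ring|].
        rewrite <- O. ring.
      + transitivity (k * k * (1 + - RtoC (v ^ 2) * z) * / (k * k)); [field; exact Hk|].
        rewrite K. ring. }
  assert (Wu : W u = 1).
  { rewrite <- W0. destruct (proj1 Hu) as [L|<-]; [|reflexivity].
    symmetry. apply is_Cderive_0_eq; [assumption|]. intros v Hv. apply DW; lra. }
  unfold W in Wu. rewrite Cpow_inv in Wu by apply Cexp_neq0.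
  assert (Hk : cos_arctan (u * t) ^ (2 + N) <> 0) by (apply Cpow_nz, Cexp_neq0).
  transitivity (CPS g (u ^ 2) * / cos_arctan (u * t) ^ (2 + N) * cos_arctan (u * t) ^ (2 + N));
    [field; exact Hk|]. rewrite Wu. ring.
Qed.

(** F stands for kappa times the primitive of sin^N that vanishes at 0, which treats both parities
    of N at once. The difference of the two sides along the ray vanishes at v = 0 and has zero
    derivative; the factor (v t)^(N+1) is kept as a multiplier, so nothing is divided by zero at v =
    0. *)
Lemma hyp2F1_eq_int_sin (F : C -> C) (kappa : C) :
  F 0 = 0 ->
  (forall f u l, is_Cderive f u l ->
    is_Cderive (fun v => F (f v)) u (kappa * Csin (f u) ^ N * l)) ->
  kappa * t ^ S N * CPS h 1 = (INR N + 1) * F (Carctan t).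
Proof.
  intros F0 DF.
  set (W := fun v : R => kappa * t ^ S N * (RtoC v ^ S N * CPS h (v ^ 2)) -
    (INR N + 1) * F (Carctan (v * t))).
  assert (W0 : W 0%R = 0).
  { unfold W. rewrite Cmult_0_l, Carctan_0, F0, !Cpow_S. ring. }
  assert (W1 : W 1%R = kappa * t ^ S N * CPS h 1 - (INR N + 1) * F (Carctan t)).
  { unfold W. rewrite Cmult_1_l, Cpow_1_l, pow1. ring. }
  apply Ceq_minus. rewrite <- W1, <- W0. symmetry.
  apply is_Cderive_0_eq; [lra|]. intros v Hv. eapply is_Cderive_val.
  - apply is_Cderive_minus; apply is_Cderive_scal;
      [|apply DF, is_Cderive_Carctan_ray; assumption].
    apply is_Cderive_mult; [apply is_Cderive_pow, is_Cderive_id|].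
    apply is_Cderive_CPS_sqr; [exact CV_gt1_h|exact Hv].
  - cbv beta. destruct al_be_pos as [Pa Pb].
    assert (Hv2 : (0 <= v ^ 2 <= 1)%R) by nra.
    assert (O := hyp2F1_contiguous al be z Pa Pb Hz Hz0 _ Hv2). fold h g in O.
    rewrite binomial_series_ray in O by assumption.
    rewrite (Csin_Carctan _ (Cmod_ray t v Ht Hv)).
    set (k := cos_arctan (v * t)) in *.
    set (H := CPS h (v ^ 2)) in *. set (H' := CPS (CPS_deriv h) (v ^ 2)) in *.
    assert (A : 2 * RtoC be = INR N + 1).
    { unfold be. rewrite <- RtoC_plus, <- RtoC_mult. f_equal. field. }
    rewrite S_INR, RtoC_plus, <- A, !Cpow_mult_l, !Cpow_S.
    rewrite RtoC_pow in O.
    (* Since sin = v t cos on the ray, sin^N times t cos^2 is v^N t^(N+1) cos^(N+2). With 2 be = N +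
       1, both derivatives share the factor outside the parentheses, and [O] cancels what is
       inside. *)
    transitivity (kappa * (t * t ^ N) * v ^ N * 2 *
      ((be * H + v ^ 2 * H') - be * k ^ (2 + N))).
    + rewrite Cpow_add_r. simpl (_ ^ 2). ring.
    + rewrite O. ring.
Qed.

Lemma is_hyp2F1_CPS : is_hyp2F1 be al (be + 1) z (CPS h 1).
Proof.
  apply is_CPS_1_is_pseries. apply CPS_correct; [exact CV_gt1_h|lra].
Qed.
End Main.

Theorem mainTheorem10 :
  forall (n : nat) (z : C), (Cmod z < 1)%R -> z <> 0 ->
  is_hyp2F1 (1 / 2 + INR n) (1 + INR n) (3 / 2 + INR n) z
    ((1 + 2 * INR n) / (4 ^ n * Cpower (- z) (INR n + 1 / 2)) *
     (binom (2 * n) n * Carcsin (Csqrt (z / (z - 1))) +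
      (-1) ^ n *
      (let term := fun k : nat =>
         (-1) ^ k * binom (2 * n) k *
         (Csin (2 * (INR n - INR k) * Carcsin (Csqrt (z / (z - 1)))) /
          (2 * (INR n - INR k))) in
       Csum term 0 n + Csum term (1 + n) (1 + 2 * n))))
  /\
  is_hyp2F1 (1 + INR n) (3 / 2 + INR n) (2 + INR n) z
    ((1 + INR n) / (4 ^ n * z ^ (1 + n)) *
     Csum (fun k : nat =>
       (-1) ^ k * binom (1 + 2 * n) k *
       ((Ccos ((2 * INR n - 2 * INR k + 1) *
               Carcsin (Csqrt (z / (z - 1)))) - 1) /
        (2 * INR n - 2 * INR k + 1)))
      0 (2 + 2 * n)).
Proof.
  intros n z Hz Hz0.
  assert (Hz0' : - z <> 0) by (intros E; apply Hz0; rewrite <- (Copp_0), <- E; ring).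
  pose proof (Csqrt_sqr _ Hz0') as Et.
  pose proof (Cmod_Csqrt_opp_lt1 z Hz Hz0) as Ht.
  (* The same root t of -z turns the power into t^(2n+1) and the arcsine into [Carctan t]. *)
  rewrite Cpower_half, Carcsin_Csqrt by assumption.
  set (t := Csqrt (- z)) in *.
  assert (Ht0 : t <> 0) by (intros E; apply Hz0'; rewrite <- Et, E; ring).
  assert (H4 : 4 ^ n <> 0) by (apply Cpow_nz, RtoC_neq0; lra).
  split.
  - change (is_hyp2F1 (1 / 2 + INR n) (1 + INR n) (3 / 2 + INR n) z
      ((1 + 2 * INR n) / (4 ^ n * t ^ (1 + 2 * n)) * int_sin_even n (Carctan t))).
    pose proof (is_hyp2F1_CPS (2 * n) z Hz Hz0) as HS.
    pose proof (hyp2F1_eq_int_sin (2 * n) z t Hz Hz0 Et Ht (int_sin_even n) (4 ^ n)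
      (int_sin_even_0 n) (is_Cderive_int_sin_even n)) as E.
    assert (Htn : t ^ S (2 * n) <> 0) by now apply Cpow_nz.
    change (1 + 2 * n)%nat with (S (2 * n)).
    assert (Ebe : RtoC ((INR (2 * n) + 1) / 2) = 1 / 2 + INR n).
    { rewrite mult_INR. change (INR 2) with 2%R.
      rewrite <- RtoC_div, <- RtoC_plus by lra. f_equal. field. }
    assert (Eal : RtoC ((INR (2 * n) + 2) / 2) = 1 + INR n).
    { rewrite mult_INR. change (INR 2) with 2%R. rewrite <- RtoC_plus. f_equal. field. }
    rewrite Ebe, Eal in *.
    replace (1 / 2 + INR n + 1) with (3 / 2 + INR n) in * by field.
    set (L := CPS _ 1) in *.
    replace (_ * int_sin_even n (Carctan t)) with L; [exact HS|].
    replace (1 + 2 * INR n) with (INR (2 * n) + 1)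
      by (rewrite mult_INR, RtoC_mult; change (INR 2) with 2%R; ring).
    transitivity (4 ^ n * t ^ S (2 * n) * L / (4 ^ n * t ^ S (2 * n)));
      [|rewrite E]; field; split; assumption.
  - change (is_hyp2F1 (1 + INR n) (3 / 2 + INR n) (2 + INR n) z
      ((1 + INR n) / (4 ^ n * z ^ (1 + n)) * int_sin_odd n (Carctan t))).
    pose proof (is_hyp2F1_CPS (1 + 2 * n) z Hz Hz0) as HS.
    pose proof (hyp2F1_eq_int_sin (1 + 2 * n) z t Hz Hz0 Et Ht (int_sin_odd n)
      (- 2 * (-1) ^ n * 4 ^ n) (int_sin_odd_0 n) (is_Cderive_int_sin_odd n)) as E.
    assert (Hzn : z ^ (1 + n) <> 0) by now apply Cpow_nz.
    assert (EN : INR (1 + 2 * n) = (2 * INR n + 1)%R).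
    { rewrite plus_INR, mult_INR. change (INR 2) with 2%R. simpl. ring. }
    assert (Ebe : RtoC ((INR (1 + 2 * n) + 1) / 2) = 1 + INR n).
    { rewrite EN, <- RtoC_plus. f_equal. field. }
    assert (Eal : RtoC ((INR (1 + 2 * n) + 2) / 2) = 3 / 2 + INR n).
    { rewrite EN, <- RtoC_div, <- RtoC_plus by lra. f_equal. field. }
    rewrite Ebe, Eal in *.
    replace (1 + INR n + 1) with (2 + INR n) in * by ring.
    set (L := CPS _ 1) in *.
    replace (_ * int_sin_odd n (Carctan t)) with L; [exact HS|].
    rewrite EN, RtoC_plus, RtoC_mult in E.
    (* The even power of t is (-z)^(n+1); its sign cancels the sign of the constant -2 (-1)^n 4^n,
       so z itself appears in the second form. *)
    assert (Etn : t ^ S (1 + 2 * n) = - (-1) ^ n * z ^ (1 + n)).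
    { replace (S (1 + 2 * n)) with (2 * (1 + n))%nat by lia.
      rewrite Cpow_mult_r. replace (t ^ 2) with (-1 * z) by (simpl; rewrite Cmult_1_r, Et; ring).
      rewrite Cpow_mult_l. simpl. ring. }
    rewrite Etn in E.
    assert (E' : 4 ^ n * z ^ (1 + n) * L = (1 + INR n) * int_sin_odd n (Carctan t)).
    { transitivity ((-1) ^ n * (-1) ^ n * (4 ^ n * z ^ (1 + n) * L));
        [rewrite Cpow_m1_sqr; ring|].
      transitivity (/ 2 * (- 2 * (-1) ^ n * 4 ^ n * (- (-1) ^ n * z ^ (1 + n)) * L)); [field|].
      rewrite E. field. }
    transitivity (4 ^ n * z ^ (1 + n) * L / (4 ^ n * z ^ (1 + n)));
      [|rewrite E']; field; split; assumption.
Qed.
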